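(* Let $X$ be a linear subspace of $L^0$, $n\ge2$, and let $\rho_1,\dots,\rho_{n-1}$ be convex, left-continuous, superadditive and monotone semimodulars on $X$. Put $\rho=\max_{1\le i\le n-1}\rho_i$ and $X_\rho=\{x\in X:\rho(\lambda x)<\infty\text{ for some }\lambda>0\}$, and assume: (i) for any $x\in X_\rho$ and $y\in L^0$ with $|y|\le|x|$ a.e., we have $y\in X_\rho$ and $\rho_i(\lambda y)\le\rho_i(\lambda x)$ for all $\lambda>0$ and $i\in\{1,\dots,n-1\}$; (ii) there is $x\in X_\rho$ with $x>0$ a.e.; (iii) for any $(x_m)\subset X_\rho$ such that $\rho(\lambda(x_k-x_j))\to0$ as $k,j\to\infty$ for every $\lambda>0$, there is $x\in X_\rho$ with $\rho(\lambda(x_m-x))\to0$ as $m\to\infty$ for every $\lambda>0$. Let $f$ be a norm on $\mathbb{R}^n$ that is uniformly monotone. If for any sequence $(x_m)\subset X_\rho$ the convergence $\rho(x_m)\to0$ implies $\rho(2x_m)\to0$, then the space $X_\rho$ equipped with the norm $$\|x\|_f=\inf_{k>0}\left\{k f\left(e_1+\sum_{i=2}^n\rho_{i-1}\left(\frac{x}{k}\right)e_i\right)\right\}$$ is uniformly monotone.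
   Context: $I=[0,\alpha)$ with $\alpha=1$ or $\alpha=\infty$, with Lebesgue measure; $L^0$ is the set of (a.e. equivalence classes of) extended real-valued Lebesgue measurable functions on $I$. $(e_i)_{i=1}^n$ is the standard basis of $\mathbb{R}^n$. A function $\rho:X\to[0,\infty]$ is a convex semimodular if: $\rho(0)=0$, and $\rho(dx)=0$ for all $d\ge0$ implies $x=0$; $\rho(dx)=\rho(x)$ for scalars $|d|=1$; $\rho(ax+by)\le a\rho(x)+b\rho(y)$ for $a,b\ge0$, $a+b=1$. A semimodular $\rho_i$ is left-continuous if $\lim_{\lambda\to\lambda_0^-}\rho_i(\lambda x)=\rho_i(\lambda_0x)$ for all $x\in X_\rho$, $\lambda_0\in(0,\infty)$; superadditive if $\rho_i(x+y)\ge\rho_i(x)+\rho_i(y)$ for all $x,y\ge0$ in $X$; monotone if $|x|\le|y|$ a.e. implies $\rho_i(x)\le\rho_i(y)$. A space $E$ with norm $\|\cdot\|_E$ and positive cone $E^+$ (here $E=X_\rho$ with the a.e. order, or $E=\mathbb{R}^n$ with norm $f$ and the coordinatewise order) is uniformly monotone if for any $\epsilon\in(0,1]$ there is $\delta_\epsilon\in(0,1]$ such that for any $x,y\in E^+$ with $x\le y$, $\|y\|_E=1$ and $\|x\|_E\ge\epsilon$ we have $\|y-x\|_E<1-\delta_\epsilon$. Convention: $f(e_1+\sum_{i=2}^nt_ie_i)=+\infty$ if some $t_i=+\infty$. *)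

(* Defs.v *)
From mathcomp Require Import all_boot all_order all_algebra.
From mathcomp Require Import all_classical all_reals all_analysis.
From mathcomp Require Import measurable_realfun.

Set Implicit Arguments.
Unset Strict Implicit.
Unset Printing Implicit Defensive.

Import Order.TTheory GRing.Theory Num.Theory.
Import numFieldNormedType.Exports.

Local Open Scope classical_set_scope.
Local Open Scope ring_scope.

(* The real line carrying the sigma-algebra of Lebesgue (i.e. Caratheodory)
   measurable sets; the plain type R carries the Borel sigma-algebra. *)
Definition lebesgueType (R : realType) :=
  caratheodory_type (wlength (@idfun R))^*%mu.

(* The interval [0, alpha); alpha is an extended real. *)
Definition Iset (R : realType) (alpha : \bar R) : set (lebesgueType R) :=
  [set t : R | 0 <= t /\ (t%:E < alpha)%E].

(* An element of L^0 is given by any representative R -> \bar R; its values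
   outside I are irrelevant, and equality is equality a.e. on I. *)
Definition aeI (R : realType) (I : set (lebesgueType R)) (P : R -> Prop) :
    Prop :=
  {ae (@completed_lebesgue_measure R), forall t, I t -> P t}.

Definition eqI (R : realType) (I : set (lebesgueType R)) (x y : R -> \bar R) :=
  aeI I (fun t => x t = y t).

Definition L0 (R : realType) (I : set (lebesgueType R)) : set (R -> \bar R) :=
  [set x | measurable_fun I (x : lebesgueType R -> \bar R)].

Definition scalef (R : realType) (c : R) (x : R -> \bar R) : R -> \bar R :=
  fun t => (c%:E * x t)%E.

(* L^0 is not itself a vector space, since +oo and -oo have no additive
   inverse: a subset of L^0 that is a vector space for the pointwise a.e.
   operations consists of a.e. finite functions, so this is required
   explicitly (the library gives +oo + -oo a default value). The second
   clause says that X is a set of a.e. classes. *)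
Record linear_subspace (R : realType) (I : set (lebesgueType R))
    (X : set (R -> \bar R)) : Prop := {
  lsub_L0 : X `<=` L0 I;
  lsub_ae : forall x y, X x -> L0 I y -> eqI I x y -> X y;
  lsub_fin : forall x, X x -> aeI I (fun t => x t \is a fin_num);
  lsub_0 : X (cst 0%E);
  lsub_add : forall x y, X x -> X y -> X (x \+ y)%E;
  lsub_scale : forall c x, X x -> X (scalef c x)
}.

(* smod_ae: rho is a function of the a.e. class. In smod_convex, the library
   convention 0 * +oo = 0 is the right one for a = 0 or b = 0. *)
Record convex_semimodular (R : realType) (I : set (lebesgueType R))
    (X : set (R -> \bar R)) (rho : (R -> \bar R) -> \bar R) : Prop := {
  smod_ae : forall x y, X x -> X y -> eqI I x y -> rho x = rho y;
  smod_ge0 : forall x, X x -> (0 <= rho x)%E;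
  smod_0 : rho (cst 0%E) = 0%E;
  smod_eq0 : forall x, X x -> (forall d : R, 0 <= d -> rho (scalef d x) = 0%E) ->
    eqI I x (cst 0%E);
  smod_unit : forall (d : R) x, X x -> `|d| = 1 -> rho (scalef d x) = rho x;
  smod_convex : forall (a b : R) x y, X x -> X y ->
    0 <= a -> 0 <= b -> a + b = 1 ->
    (rho (scalef a x \+ scalef b y) <= a%:E * rho x + b%:E * rho y)%E
}.

Definition left_continuous_on (R : realType) (Y : set (R -> \bar R))
    (rho : (R -> \bar R) -> \bar R) : Prop :=
  forall x, Y x -> forall l0 : R, 0 < l0 ->
    rho (scalef l x) @[l --> l0^'-] --> rho (scalef l0 x).

Definition superadditive_on (R : realType) (I : set (lebesgueType R))
    (X : set (R -> \bar R)) (rho : (R -> \bar R) -> \bar R) : Prop :=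
  forall x y, X x -> X y ->
    aeI I (fun t => 0 <= x t)%E -> aeI I (fun t => 0 <= y t)%E ->
    (rho x + rho y <= rho (x \+ y))%E.

Definition monotone_on (R : realType) (I : set (lebesgueType R))
    (X : set (R -> \bar R)) (rho : (R -> \bar R) -> \bar R) : Prop :=
  forall x y, X x -> X y ->
    aeI I (fun t => `|x t| <= `|y t|)%E -> (rho x <= rho y)%E.

(* The default value 0 does not affect the maximum of a nonempty family of
   nonnegative values. *)
Definition max_rho (R : realType) (p : nat)
    (rho : 'I_p -> (R -> \bar R) -> \bar R) (x : R -> \bar R) : \bar R :=
  \big[maxe/0%E]_(i < p) rho i x.

Definition modular_space (R : realType) (X : set (R -> \bar R))
    (rho : (R -> \bar R) -> \bar R) : set (R -> \bar R) :=
  [set x | X x /\ exists2 l : R, 0 < l & (rho (scalef l x) < +oo)%E].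

Record is_norm (R : realType) (n : nat) (f : 'rV[R]_n -> R) : Prop := {
  norm_ge0 : forall u, 0 <= f u;
  norm_eq0 : forall u, f u = 0 -> u = 0;
  norm_scale : forall c u, f (c *: u) = `|c| * f u;
  norm_triangle : forall u v, f (u + v) <= f u + f v
}.

(* Uniform monotonicity of a space with positive cone pos, order le,
   subtraction sub and norm N. *)
Definition uniformly_monotone (R : realType) (E : Type) (pos : set E)
    (le : E -> E -> Prop) (sub : E -> E -> E) (N : E -> \bar R) : Prop :=
  forall eps : R, 0 < eps <= 1 ->
    exists2 delta : R, 0 < delta <= 1 &
      forall x y, pos x -> pos y -> le x y -> N y = 1%E -> (eps%:E <= N x)%E ->
        (N (sub y x) < (1 - delta)%:E)%E.

Definition uniformly_monotone_rV (R : realType) (n : nat) (f : 'rV[R]_n -> R) :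
    Prop :=
  uniformly_monotone [set u : 'rV[R]_n | forall j, 0 <= u 0 j]
    (fun u v => forall j, u 0 j <= v 0 j) (fun u v => u - v) (EFin \o f).

Definition uniformly_monotone_fun (R : realType) (I : set (lebesgueType R))
    (Y : set (R -> \bar R)) (N : (R -> \bar R) -> \bar R) : Prop :=
  uniformly_monotone [set x | Y x /\ aeI I (fun t => 0 <= x t)%E]
    (fun x y => aeI I (fun t => x t <= y t)%E) (fun x y => x \- y)%E N.

(* f (e_1 + \sum_i t_i e_(i+1)), which is +oo if some t_i is. *)
Definition fext (R : realType) (p : nat) (f : 'rV[R]_p.+1 -> R)
    (t : 'I_p -> \bar R) : \bar R :=
  if [exists i, t i == +oo%E] then +oo%E
  else (f (delta_mx 0 ord0
           + \sum_(i < p) fine (t i) *: delta_mx 0 (lift ord0 i)))%:E.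

Definition norm_f (R : realType) (p : nat) (f : 'rV[R]_p.+1 -> R)
    (rho : 'I_p -> (R -> \bar R) -> \bar R) (x : R -> \bar R) : \bar R :=
  ereal_inf [set (k%:E * fext f (fun i => rho i (scalef k^-1 x)))%E
            | k in [set k : R | 0 < k]].

(* Main.v *)
Require Import Defs.
From mathcomp Require Import all_boot all_order all_algebra.
From mathcomp Require Import all_classical all_reals all_analysis.
From mathcomp Require Import measurable_realfun.
From mathcomp Require Import ring lra.

Import Order.TTheory GRing.Theory Num.Theory.
Import numFieldNormedType.Exports.

Local Open Scope classical_set_scope.
Local Open Scope ring_scope.

(* Let c = f e_1, 0 <= x <= y with norm 1 for y and at least eps for x, and choose
   k nearly optimal for y; put v = e_1 + sum_i rho_i(y/k) e_(i+1) and
   u = sum_i rho_i(x/k) e_(i+1). Superadditivity bounds the norm of y - x by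
   k f(v - u), and uniform monotonicity of f makes k f(v - u) smaller than k f v
   by a definite factor once k f u is bounded below. For k' = eps/(2c) the
   triangle inequality gives k' f(sum_i rho_i(x/k') e_(i+1)) >= eps/2. If
   k <= k', this passes to k since k rho_i(x/k) is nonincreasing in k by
   convexity; if k > k', then k <= 2/c makes 1/k' at most a fixed power of 2
   times 1/k, and the Delta_2 condition, which is automatically uniform,
   bounds max_i rho_i(x/k) from below. *)

(** * Vectors with vanishing first coordinate *)

(** Literally the sum occurring in [fext], so that a finite value of [fext] unfolds to
    [f (delta_mx 0 ord0 + tailv _)]. *)
Definition tailv {R : realType} {p : nat} (t : 'I_p -> R) : 'rV[R]_p.+1 :=
  \sum_(i < p) t i *: delta_mx 0 (lift ord0 i).

Lemma tailv0 {R : realType} {p : nat} (t : 'I_p -> R) : tailv t 0 ord0 = 0.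
Proof.
by rewrite /tailv summxE big1 // => i _; rewrite !mxE mulr0.
Qed.

Lemma tailv_lift {R : realType} {p : nat} (t : 'I_p -> R) i :
  tailv t 0 (lift ord0 i) = t i.
Proof.
rewrite /tailv summxE (bigD1 i) //= !mxE !eqxx mulr1 big1 ?addr0 // => j ji.
by rewrite !mxE eqxx (inj_eq lift_inj) eq_sym (negbTE ji) mulr0.
Qed.

Lemma tailvZ {R : realType} {p : nat} (k : R) (t : 'I_p -> R) :
  k *: tailv t = tailv (fun i => k * t i).
Proof. by rewrite /tailv scaler_sumr; apply: eq_bigr => i _; rewrite scalerA. Qed.

Lemma tailv_ge0 {R : realType} {p : nat} (t : 'I_p -> R) :
  (forall i, 0 <= t i) -> forall j, 0 <= tailv t 0 j.
Proof.
move=> t0 j; case: (unliftP ord0 j) => [i ->|->].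
  by rewrite tailv_lift.
by rewrite tailv0.
Qed.

Lemma tailv_le {R : realType} {p : nat} (s t : 'I_p -> R) :
  (forall i, s i <= t i) -> forall j, tailv s 0 j <= tailv t 0 j.
Proof.
move=> st j; case: (unliftP ord0 j) => [i ->|->].
  by rewrite !tailv_lift.
by rewrite !tailv0.
Qed.

(** * Norms on R^n and their uniform monotonicity *)

Lemma norm_delta_gt0 {R : realType} {n : nat} {f : 'rV[R]_n -> R} :
  is_norm f -> forall j, 0 < f (delta_mx 0 j).
Proof.
move=> hf j; rewrite lt_neqAle (norm_ge0 hf) andbT eq_sym; apply/eqP.
move=> /(norm_eq0 hf)/matrixP/(_ 0 j)/eqP.
by rewrite !mxE !eqxx oner_eq0.
Qed.

Lemma norm0 {R : realType} {n : nat} {f : 'rV[R]_n -> R} :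
  is_norm f -> f 0 = 0.
Proof. by move=> hf; rewrite -(scale0r 0) (norm_scale hf) normr0 mul0r. Qed.

Lemma norm_tailv_le {R : realType} {p : nat} {f : 'rV[R]_p.+1 -> R}
    (hf : is_norm f) (t : 'I_p -> R) (b : R) :
  (forall i, 0 <= t i <= b) ->
  f (tailv t) <= b * \sum_(i < p) f (delta_mx 0 (lift ord0 i)).
Proof.
move=> tb; rewrite mulr_sumr /tailv.
elim/big_ind2: _ => [|x1 x2 y1 y2 h1 h2|i _]; first by rewrite norm0.
  by rewrite (le_trans (norm_triangle hf _ _))// lerD.
have /andP[t0 tlb] := tb i.
by rewrite (norm_scale hf) ger0_norm // ler_wpM2r // (norm_ge0 hf).
Qed.

(** Dividing [u] and [v] by [f v] reduces this to the normalized case, by homogeneity. *)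
Lemma um_norm_scaled {R : realType} {n : nat} {f : 'rV[R]_n -> R} :
  is_norm f -> uniformly_monotone_rV f -> forall eps : R, 0 < eps <= 1 ->
  exists2 d : R, 0 < d <= 1 & forall u v : 'rV[R]_n,
    (forall j, 0 <= u 0 j) -> (forall j, u 0 j <= v 0 j) -> 0 < f v ->
    eps * f v <= f u -> f (v - u) < (1 - d) * f v.
Proof.
move=> hf hum eps he; have [d hd H] := hum eps he; exists d => // u v u0 uv v0 euv.
have Z w : f ((f v)^-1 *: w) = (f v)^-1 * f w.
  by rewrite (norm_scale hf) ger0_norm // invr_ge0 ltW.
have vi : 0 <= (f v)^-1 by rewrite invr_ge0 ltW.
have := H ((f v)^-1 *: u) ((f v)^-1 *: v).
rewrite -scalerBr /= !Z !lte_fin lee_fin mulVf ?gt_eqF //.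
rewrite ltr_pdivrMl // (mulrC (f v)); apply => //.
- by move=> j; rewrite !mxE mulr_ge0.
- by move=> j; rewrite !mxE mulr_ge0 // (le_trans (u0 j)).
- by move=> j; rewrite !mxE ler_wpM2l.
- by rewrite ler_pdivlMl // mulrC.
Qed.

(** Uniform monotonicity is applied to [v - u] below [v], whose difference is [u]; it gives
    [f u < (1 - d) * f v]. The degenerate cases [f v = 0] and [f (v - u) = 0], which leave no
    positive [eps], are treated first. *)
Lemma um_norm_mono {R : realType} {n : nat} {f : 'rV[R]_n -> R} :
  is_norm f -> uniformly_monotone_rV f -> forall u v : 'rV[R]_n,
    (forall j, 0 <= u 0 j) -> (forall j, u 0 j <= v 0 j) -> f u <= f v.
Proof.
move=> hf hum u v u0 uv.
have [v0|vpos] := eqVneq (f v) 0.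
  have v00 := norm_eq0 hf v0.
  suff -> : u = 0 by rewrite norm0 // (norm_ge0 hf).
  apply/rowP => j; apply/eqP; rewrite mxE eq_le u0 andbT.
  by have := uv j; rewrite v00 mxE.
have {}vpos : 0 < f v by rewrite lt_neqAle eq_sym vpos (norm_ge0 hf).
have [w0|wpos] := eqVneq (f (v - u)) 0.
  by rewrite (subr0_eq (norm_eq0 hf w0)).
have {}wpos : 0 < f (v - u) by rewrite lt_neqAle eq_sym wpos (norm_ge0 hf).
pose eps := Num.min 1 (f (v - u) / f v).
have he : 0 < eps <= 1 by rewrite lt_min ltr01 divr_gt0 // ge_min lexx.
have [d /andP[d0 _] H] := um_norm_scaled hf hum _ he.
have := H (v - u) v; rewrite subKr => /(_ _ _ vpos) K.
apply: le_trans (ltW (K _ _ _)) _.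
- by move=> j; rewrite !mxE subr_ge0.
- by move=> j; rewrite !mxE lerBlDr lerDl.
- by rewrite -ler_pdivlMr // ge_min lexx orbT.
- by rewrite ler_piMl ?(ltW vpos) // lerBlDr lerDl ltW.
Qed.

(** * Scaling of convex semimodulars and the Delta_2 condition *)

Lemma scalefA {R : realType} (a b : R) (x : R -> \bar R) :
  scalef a (scalef b x) = scalef (a * b) x.
Proof. by apply/funext => t; rewrite /scalef muleA EFinM. Qed.

(** Convexity for [x] and the zero function, with weights [a] and [1 - a]. *)
Lemma convex_semimodular_scale_le {R : realType} {I : set (lebesgueType R)}
    {X : set (R -> \bar R)} {r : (R -> \bar R) -> \bar R} :
  linear_subspace I X -> convex_semimodular I X r ->
  forall (a : R) x, X x -> 0 <= a <= 1 -> (r (scalef a x) <= a%:E * r x)%E.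
Proof.
move=> hX hr a x Xx /andP[a0 a1].
have := smod_convex hr Xx (lsub_0 hX) a0 (_ : 0 <= 1 - a) _.
rewrite (smod_0 hr) mule0 adde0 subr_ge0 addrC subrK => /(_ a1 erefl).
rewrite [X in r X](_ : _ = scalef a x) //; apply/funext => t.
by rewrite /scalef /= mule0 adde0.
Qed.

Lemma convex_semimodular_scale_mono {R : realType} {I : set (lebesgueType R)}
    {X : set (R -> \bar R)} {r : (R -> \bar R) -> \bar R} :
  linear_subspace I X -> convex_semimodular I X r ->
  forall (a b : R) x, X x -> 0 <= a <= b ->
  (r (scalef a x) <= r (scalef b x))%E.
Proof.
move=> hX hr a b x Xx /andP[a0 ab].
have [b0|bn0] := eqVneq b 0.
  by rewrite (_ : a = b) //; apply/eqP; rewrite eq_le ab b0.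
have bpos : 0 < b by rewrite lt_neqAle eq_sym bn0 (le_trans a0).
have Xb := lsub_scale hX b Xx.
have q1 : 0 <= a / b <= 1 by rewrite divr_ge0 ?(ltW bpos) //= ler_pdivrMr ?mul1r.
have := convex_semimodular_scale_le hX hr _ _ Xb q1.
rewrite scalefA divfK // => /le_trans; apply.
apply: gee_pMl; rewrite ?lee_fin; first by [].
- exact: (smod_ge0 hr).
- by case/andP: q1.
Qed.

Lemma max_rho_ge0 {R : realType} {p : nat}
    (rho : 'I_p -> (R -> \bar R) -> \bar R) x : (0 <= max_rho rho x)%E.
Proof. exact: bigmax_ge_id. Qed.

Lemma modular_space_scale {R : realType} {I : set (lebesgueType R)}
    {X : set (R -> \bar R)} (M : (R -> \bar R) -> \bar R) :
  linear_subspace I X -> forall (c : R) x, 0 < c ->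
  modular_space X M x -> modular_space X M (scalef c x).
Proof.
move=> hX c x c0 [Xx [l l0 fin]]; split; first exact: (lsub_scale hX).
by exists (l / c); rewrite ?divr_gt0 // scalefA divfK ?gt_eqF.
Qed.

(** A failure for a single doubling produces a sequence contradicting the sequential hypothesis; [N]
    doublings follow by induction. *)
Lemma delta2_uniform {R : realType} {Y : set (R -> \bar R)}
    {M : (R -> \bar R) -> \bar R} :
  (forall x, 0 <= M x)%E ->
  (forall x, Y x -> Y (scalef 2 x)) ->
  (forall x : nat -> R -> \bar R, (forall m, Y (x m)) ->
     M (x m) @[m --> \oo] --> 0%E ->
     M (scalef 2 (x m)) @[m --> \oo] --> 0%E) ->
  forall (N : nat) (a : R), 0 < a -> exists2 eta : R, 0 < eta &
    forall z, Y z -> (a%:E <= M (scalef (2 ^+ N) z))%E -> (eta%:E <= M z)%E.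
Proof.
move=> M0 Y2 D2; elim=> [|N IH] a a0.
  exists a => // z _; rewrite expr0.
  by rewrite (_ : scalef 1 z = z) //; apply/funext => t; rewrite /scalef mul1e.
have [b b0 Hb] : exists2 eta : R, 0 < eta &
    forall z, Y z -> (a%:E <= M (scalef 2 z))%E -> (eta%:E <= M z)%E.
  (* If no [eta] works, each [harmonic m] fails, and the witnesses [x m] have [M (x m)] tending to 0
     while [M (scalef 2 (x m))] stays at least [a]. *)
  apply: contrapT => H.
  have /choice[x Hx] : forall m : nat, exists z,
      [/\ Y z, (a%:E <= M (scalef 2 z))%E & (M z <= (harmonic m)%:E)%E].
    move=> m; apply: contrapT => Hm; apply: H.
    exists (harmonic m) => [|z Yz az]; first exact: harmonic_gt0.
    by rewrite leNgt; apply/negP => zm; apply: Hm; exists z; split=> //; exact: ltW.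
  have x0 : M (x m) @[m --> \oo] --> 0%E.
    apply: (@squeeze_cvge _ _ _ _ (cst 0%E) _ (EFin \o harmonic)).
    - by near=> m; rewrite M0; case: (Hx m).
    - exact: cvg_cst.
    - exact: cvge_harmonic.
  have := D2 x (fun m => let: And3 h _ _ := Hx m in h) x0.
  move/fine_cvgP => [fin /cvgr0Pnorm_lt/(_ a a0) small].
  have [m [] mfin] : exists m, M (scalef 2 (x m)) \is a fin_num /\
      `|fine (M (scalef 2 (x m)))| < a.
    by near \oo => m; exists m; split; near: m.
  rewrite ger0_norm ?fine_ge0 // -lte_fin fineK // ltNge.
  by case: (Hx m) => _ ->.
have [eta eta0 Heta] := IH b b0; exists eta => // z Yz az.
apply: Heta => //; apply: Hb.
  elim: N {IH az} => [|N IH] //.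
    rewrite expr0 (_ : scalef 1 z = z) //; apply/funext => t.
    by rewrite /scalef mul1e.
  by rewrite exprS -scalefA; apply: Y2.
by rewrite scalefA -exprS.
Unshelve. all: by end_near.
Qed.

(** * Bounds relating [norm_f] to the values of the semimodulars *)

Lemma norm_f_le {R : realType} {p : nat} (f : 'rV[R]_p.+1 -> R)
    (rho : 'I_p -> (R -> \bar R) -> \bar R) (x : R -> \bar R) (k : R) :
  0 < k -> (forall i, rho i (scalef k^-1 x) \is a fin_num) ->
  (norm_f f rho x <= (k * f (delta_mx 0 ord0 +
    tailv (fun i => fine (rho i (scalef k^-1 x)))))%:E)%E.
Proof.
move=> k0 fin; apply: ereal_inf_lbound; exists k => //.
rewrite /fext ifF ?EFinM //; apply/negbTE/negP => /'exists_eqP[i E].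
by have := fin i; rewrite E.
Qed.

(** The condition [k * f (delta_mx 0 ord0) <= 2] bounds [k] from above, so that a number of
    doublings independent of [x] and [k] leads from x/k past x/k'. *)
Lemma tailv_lower_bound {R : realType} {I : set (lebesgueType R)}
    {X : set (R -> \bar R)} {p : nat}
    {rho : 'I_p -> (R -> \bar R) -> \bar R} {f : 'rV[R]_p.+1 -> R} :
  linear_subspace I X -> (forall i, convex_semimodular I X (rho i)) ->
  is_norm f -> uniformly_monotone_rV f ->
  (forall x : nat -> R -> \bar R,
     (forall m, modular_space X (max_rho rho) (x m)) ->
     max_rho rho (x m) @[m --> \oo] --> 0%E ->
     max_rho rho (scalef 2 (x m)) @[m --> \oo] --> 0%E) ->
  forall eps : R, 0 < eps -> exists2 e : R, 0 < e & forall x (k : R),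
    modular_space X (max_rho rho) x -> (eps%:E <= norm_f f rho x)%E ->
    0 < k -> k * f (delta_mx 0 ord0) <= 2 ->
    (forall i, rho i (scalef k^-1 x) \is a fin_num) ->
    e <= k * f (tailv (fun i => fine (rho i (scalef k^-1 x)))).
Proof.
move=> hX hsemi hf hum hD2 eps eps0.
set c := f (delta_mx 0 ord0).
have c0 : 0 < c by exact: norm_delta_gt0.
(* The [e_1] term then costs [k' * c = eps / 2], and half of [eps] is left for the tail. *)
pose k' := eps / (2 * c).
have k'0 : 0 < k' by rewrite divr_gt0 // mulr_gt0.
have k'c : k' * c = eps / 2 by rewrite /k'; field; rewrite gt_eqF.
pose S := \sum_(i < p) f (delta_mx 0 (lift ord0 i)).
have S0 : 0 <= S by apply: sumr_ge0 => i _; exact: norm_ge0.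
have S1 : 0 < S + 1 by lra.
(* Any positive default would do: only [0 < m] and [m <= f (delta_mx 0 (lift ord0 j))] matter. *)
pose m := \big[Order.min/1]_(i < p) f (delta_mx 0 (lift ord0 i)).
have m0 : 0 < m by apply: lt_bigmin => // i _; exact: norm_delta_gt0.
(* [4 / eps] bounds k/k', because k is at most 2/c. *)
have [N hN] : exists N, 4 / eps < 2 ^+ N.
  by exists (Num.Def.archi_bound (4 / eps)); exact: upper_nthrootP.
(* If every [rho i] at x/k' were below [c / (S + 1)], the tail would have norm at most
   [c * S / (S + 1)], hence below [c], against [tail'] and [k' * c = eps / 2]. The added 1 makes
   this strict and allows [S = 0]. *)
have [eta eta0 Heta] := delta2_uniform (max_rho_ge0 rho)
  (fun x => modular_space_scale _ hX 2 x (ltr0Sn R 1)) hD2 N (c / (S + 1))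
  (divr_gt0 c0 S1).
(* The first entry serves the case [k <= k'], the second the case [k' < k]. *)
exists (Num.min (eps / 2) (k' * (eta * m))).
  by rewrite lt_min divr_gt0 ?ltr0n //=; rewrite (mulr_gt0 k'0) ?mulr_gt0.
move=> x k Yx Nx k0 kc fin; have Xx := Yx.1.
have t0 l i : 0 <= fine (rho i (scalef l x)).
  by rewrite fine_ge0 // (smod_ge0 (hsemi i)) //; exact: (lsub_scale hX).
have tail' : (forall i, rho i (scalef k'^-1 x) \is a fin_num) ->
    eps / 2 <= k' * f (tailv (fun i => fine (rho i (scalef k'^-1 x)))).
  move=> fin'; have := le_trans Nx (norm_f_le f _ _ _ k'0 fin').
  rewrite lee_fin => /le_trans/(_ (ler_wpM2l (ltW k'0) (norm_triangle hf _ _))).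
  by rewrite mulrDr -/c k'c; lra.
have [kk'|k'k] := leP k k'.
- have le_i i : (rho i (scalef k'^-1 x) <=
      (k / k')%:E * rho i (scalef k^-1 x))%E.
    have -> : scalef k'^-1 x = scalef (k / k') (scalef k^-1 x).
      by rewrite scalefA mulrAC divff ?gt_eqF // mul1r.
    apply: (convex_semimodular_scale_le hX (hsemi i)).
      exact: (lsub_scale hX).
    by rewrite divr_ge0 ?(ltW k0) ?(ltW k'0) //= ler_pdivrMr // mul1r.
  have fin' i : rho i (scalef k'^-1 x) \is a fin_num.
    rewrite ge0_fin_numE; last first.
      by apply: (smod_ge0 (hsemi i)); exact: (lsub_scale hX).
    by rewrite (le_lt_trans (le_i i)) // -(fineK (fin i)) -EFinM ltry.
  rewrite ge_min (le_trans (tail' fin')) //.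
  rewrite -[X in X * f _](ger0_norm (ltW k'0)) -[X in _ <= X * f _](ger0_norm (ltW k0)).
  rewrite -!(norm_scale hf) !tailvZ.
  apply: (um_norm_mono hf hum); first by apply: tailv_ge0 => i; rewrite mulr_ge0 // ltW.
  apply: tailv_le => i.
  have := le_i i; rewrite -(fineK (fin' i)) -(fineK (fin i)) -EFinM lee_fin /=.
  by rewrite mulrAC ler_pdivlMr // mulrC.
- have : (eta%:E <= max_rho rho (scalef k^-1 x))%E.
    apply: Heta.
      by apply: (modular_space_scale _ hX) => //; rewrite invr_gt0.
    rewrite leNgt; apply/negP => /bigmax_ltP[_ small].
    have lt_i i : (rho i (scalef k'^-1 x) < (c / (S + 1))%:E)%E.
      apply: le_lt_trans (small i isT); rewrite scalefA.
      apply: (convex_semimodular_scale_mono hX (hsemi i)) => //.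
      rewrite invr_ge0 ltW //= ler_pdivlMr // (le_trans _ (ltW hN)) //.
      rewrite mulrC ler_pdivrMr // mulrAC ler_pdivlMr // /k'.
      have -> : 4 * (eps / (2 * c)) = 2 * eps / c by field; rewrite gt_eqF.
      by rewrite ler_pdivlMr // mulrAC ler_pM2r.
    have fin' i : rho i (scalef k'^-1 x) \is a fin_num.
      rewrite ge0_fin_numE; last first.
        by apply: (smod_ge0 (hsemi i)); exact: (lsub_scale hX).
      by rewrite (lt_trans (lt_i i)) // ltry.
    have tb i : 0 <= fine (rho i (scalef k'^-1 x)) <= c / (S + 1).
      by rewrite t0 /= -lee_fin fineK // ltW.
    have ft : f (tailv (fun i => fine (rho i (scalef k'^-1 x)))) < c.
      apply: le_lt_trans (norm_tailv_le hf _ _ tb) _.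
      by rewrite -/S mulrAC ltr_pdivrMr // ltr_pM2l // ltrDl.
    have := tail' fin'; apply/negP.
    by rewrite -ltNge -k'c (ltr_pM2l k'0).
  (* The default 0 is below [eta], so some [rho j] reaches it; the tail dominates its [j]-th
     component, of norm at least [eta * m]. *)
  move=> /bigmax_geP[|[j _ etaj]]; first by rewrite lee_fin leNgt eta0.
  rewrite ge_min; apply/orP; right.
  apply: ler_pM => //; [exact: ltW|by rewrite mulr_ge0 // ltW|exact: ltW|].
  have tj : eta <= fine (rho j (scalef k^-1 x)) by rewrite -lee_fin fineK.
  apply: (@le_trans _ _ (f (fine (rho j (scalef k^-1 x)) *:
    delta_mx 0 (lift ord0 j)))).
    rewrite (norm_scale hf) ger0_norm //.
    apply: ler_pM => //; [exact: ltW|exact: ltW|].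
    exact: bigmin_le.
  apply: (um_norm_mono hf hum) => i; first by rewrite !mxE mulr_ge0.
  case: (unliftP ord0 i) => [l ->|->]; last by rewrite tailv0 !mxE mulr0.
  rewrite tailv_lift !mxE eqxx (inj_eq lift_inj) /=.
  by have [->|_] := eqVneq l j; rewrite ?mulr1 ?mulr0.
Qed.

(** * Almost everywhere implications, and the theorem *)

Lemma aeI_imp2 {R : realType} {I : set (lebesgueType R)} {P Q S : R -> Prop} :
  (forall t, P t -> Q t -> S t) -> aeI I P -> aeI I Q -> aeI I S.
Proof.
move=> PQS; rewrite /aeI => hP hQ; apply: filterS2 hP hQ => t Pt Qt It.
by apply: PQS; [exact: Pt|exact: Qt].
Qed.

Lemma aeI_imp {R : realType} {I : set (lebesgueType R)} {P Q : R -> Prop} :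
  (forall t, P t -> Q t) -> aeI I P -> aeI I Q.
Proof. by move=> PQ hP; apply: (aeI_imp2 _ hP hP) => t /PQ. Qed.

(* p is the number n - 1 >= 1 of semimodulars, so that R^n is 'rV[R]_p.+1. *)
Theorem theorem5p3 (R : realType) (alpha : \bar R)
  (halpha : alpha = 1%E \/ alpha = +oo%E)
  (X : set (R -> \bar R)) (hX : linear_subspace (Iset alpha) X)
  (p : nat) (hp : (1 <= p)%N)
  (rho : 'I_p -> (R -> \bar R) -> \bar R)
  (hsemi : forall i, convex_semimodular (Iset alpha) X (rho i))
  (hleft : forall i,
     left_continuous_on (modular_space X (max_rho rho)) (rho i))
  (hsuper : forall i, superadditive_on (Iset alpha) X (rho i))
  (hmono : forall i, monotone_on (Iset alpha) X (rho i))
  (hi : forall x y : R -> \bar R, modular_space X (max_rho rho) x ->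
     L0 (Iset alpha) y ->
     aeI (Iset alpha) (fun t => `|y t| <= `|x t|)%E ->
     modular_space X (max_rho rho) y /\
     forall (l : R) i, 0 < l -> (rho i (scalef l y) <= rho i (scalef l x))%E)
  (hii : exists2 x : R -> \bar R, modular_space X (max_rho rho) x &
     aeI (Iset alpha) (fun t => 0 < x t)%E)
  (hiii : forall x : nat -> R -> \bar R,
     (forall m, modular_space X (max_rho rho) (x m)) ->
     (forall l : R, 0 < l ->
        max_rho rho (scalef l (x kj.1 \- x kj.2)%E)
          @[kj --> (\oo, \oo)] --> 0%E) ->
     exists2 z : R -> \bar R, modular_space X (max_rho rho) z &
       forall l : R, 0 < l ->
         max_rho rho (scalef l (x m \- z)%E) @[m --> \oo] --> 0%E)
  (f : 'rV[R]_p.+1 -> R) (hf : is_norm f) (hfum : uniformly_monotone_rV f)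
  (hdelta2 : forall x : nat -> R -> \bar R,
     (forall m, modular_space X (max_rho rho) (x m)) ->
     max_rho rho (x m) @[m --> \oo] --> 0%E ->
     max_rho rho (scalef 2 (x m)) @[m --> \oo] --> 0%E) :
  uniformly_monotone_fun (Iset alpha) (modular_space X (max_rho rho))
    (norm_f f rho).
Proof.
move=> eps /andP[eps0 eps1].
set c := f (delta_mx 0 ord0).
have c0 : 0 < c by exact: norm_delta_gt0.
have [e e0 He] := tailv_lower_bound hX hsemi hf hfum hdelta2 eps eps0.
(* Since [k * f v] will be at most 2, a bound [e <= k * f u] yields the ratio [e / 2] between [f u]
   and [f v]. *)
have he : 0 < Num.min 1 (e / 2) <= 1.
  by rewrite lt_min ltr01 divr_gt0 // ge_min lexx.
have [d /andP[d0 d1] Hd] := um_norm_scaled hf hfum _ he.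
(* With [k * f v < 1 + d / 2], the final bound is [(1 - d) * (1 + d / 2) <= 1 - d / 2]. *)
exists (d / 2); first by apply/andP; split; lra.
move=> x y [Yx x0] [Yy y0] xy Ny Nx.
have [Xx Xy] : X x /\ X y by split; [exact: Yx.1|exact: Yy.1].
have : (norm_f f rho y < (1 + d / 2)%:E)%E by rewrite Ny lte_fin; lra.
move=> /ereal_inf_lt[_ [k k0 <-]].
rewrite /fext; case: ifPn => [_|/existsPn yfin].
  by rewrite gt0_muley // lte_fin.
rewrite -EFinM lte_fin -/c.
set ty := fun i => fine (rho i (scalef k^-1 y)).
rewrite -[X in f (_ + X)]/(tailv ty) => ky.
pose z := (y \- x)%E.
have Xz : X z.
  have := lsub_add hX Xy (lsub_scale hX (-1) Xx); congr (X _).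
  by apply/funext => t; rewrite /scalef /z /= mulN1e.
have ki : 0 <= k^-1 by rewrite invr_ge0 ltW.
have Xk w : X w -> X (scalef k^-1 w) by exact: (lsub_scale hX).
have r0 i w : X w -> (0 <= rho i (scalef k^-1 w))%E.
  by move=> /Xk; exact: (smod_ge0 (hsemi i)).
have super i :
    (rho i (scalef k^-1 x) + rho i (scalef k^-1 z) <= rho i (scalef k^-1 y))%E.
  (* The identity y/k = x/k + z/k is checked where [x] is finite, hence a.e., which is enough for
     [rho i]. *)
  have -> : rho i (scalef k^-1 y) =
      rho i (scalef k^-1 x \+ scalef k^-1 z)%E.
    apply: (smod_ae (hsemi i)).
    - exact: Xk.
    - by apply: (lsub_add hX); exact: Xk.
    - apply: (aeI_imp _ (lsub_fin hX Xx)) => t xt.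
      rewrite /scalef /z /= -muleDr //; last by rewrite fin_num_adde_defr.
      by rewrite addeC subeK.
  apply: hsuper; [exact: Xk|exact: Xk| |].
  - by apply: (aeI_imp _ x0) => t xt; apply: mule_ge0; rewrite ?lee_fin.
  - apply: (aeI_imp2 _ xy (lsub_fin hX Xx)) => t xyt xt.
    apply: mule_ge0; first by rewrite lee_fin.
    by rewrite /z /= sube_ge0 ?xyt ?xt.
have fin_y i : rho i (scalef k^-1 y) \is a fin_num.
  by rewrite ge0_fin_numE ?r0 // ltey; exact: yfin.
have fin_x i : rho i (scalef k^-1 x) \is a fin_num.
  rewrite ge0_fin_numE ?r0 // (@le_lt_trans _ _ (rho i (scalef k^-1 y))) //.
    by apply: le_trans (super i); rewrite leeDl ?r0.
  by rewrite ltey; exact: yfin.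
have fin_z i : rho i (scalef k^-1 z) \is a fin_num.
  rewrite ge0_fin_numE ?r0 // (@le_lt_trans _ _ (rho i (scalef k^-1 y))) //.
    by apply: le_trans (super i); rewrite leeDr ?r0.
  by rewrite ltey; exact: yfin.
pose tx i := fine (rho i (scalef k^-1 x)).
pose tz i := fine (rho i (scalef k^-1 z)).
have tx0 i : 0 <= tx i by rewrite fine_ge0 ?r0.
have tz0 i : 0 <= tz i by rewrite fine_ge0 ?r0.
have txyz i : tx i + tz i <= ty i.
  by rewrite -lee_fin EFinD !fineK.
have e1_ge0 j : 0 <= (delta_mx 0 ord0 : 'rV[R]_p.+1) 0 j.
  by rewrite mxE eqxx /=; case: (j == ord0).
pose v := delta_mx 0 ord0 + tailv ty.
have cv : c <= f v.
  apply: (um_norm_mono hf hfum) => // j; rewrite [v 0 j]mxE lerDl.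
  apply: tailv_ge0 => i; rewrite (le_trans _ (txyz i)) // addr_ge0 //.
(* In fact [k * c <= k * f v < 1 + d / 2 <= 3 / 2]. *)
have kc : k * c <= 2.
  have : k * c <= k * f v by rewrite ler_pM2l.
  by rewrite -/v in ky; lra.
have xlow := He x k Yx Nx k0 kc fin_x; rewrite -/tx in xlow.
have uv j : tailv tx 0 j <= v 0 j.
  rewrite mxE ler_wpDl //; apply: tailv_le => i.
  by apply: le_trans (txyz i); rewrite lerDl.
apply: le_lt_trans (norm_f_le f _ _ _ k0 fin_z) _; rewrite lte_fin -/tz.
(* Superadditivity in the form [txyz] gives this inequality coordinatewise. *)
have zle : f (delta_mx 0 ord0 + tailv tz) <= f (v - tailv tx).
  apply: (um_norm_mono hf hfum) => j.
    by rewrite mxE addr_ge0 // tailv_ge0.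
  rewrite !mxE -addrA lerD2l; case: (unliftP ord0 j) => [i ->|->].
    by rewrite !tailv_lift lerBrDl.
  by rewrite !tailv0 subr0.
have vsmall : f (v - tailv tx) < (1 - d) * f v.
  apply: Hd => //; first exact: tailv_ge0.
    exact: lt_le_trans cv.
  (* After multiplication by [k], the left side is at most [e / 2 * 2 = e], which [xlow] bounds by
     [k * f (tailv tx)]. *)
  rewrite -(ler_pM2l k0) (le_trans _ xlow) // mulrCA.
  apply: (@le_trans _ _ (e / 2 * 2)); last by rewrite divfK.
  have kv0 : 0 <= k * f v by rewrite mulr_ge0 ?(ltW k0) ?(norm_ge0 hf).
  apply: ler_pM => //.
  - by rewrite le_min ler01 divr_ge0 // ltW.
  - by rewrite ge_min lexx orbT.
  - by rewrite -/v in ky; lra.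
apply: (@lt_le_trans _ _ ((1 - d) * (k * f v))).
  by rewrite mulrCA ltr_pM2l // (le_lt_trans zle).
apply: (@le_trans _ _ ((1 - d) * (1 + d / 2))).
  by rewrite ler_wpM2l ?subr_ge0 // ltW.
have : 0 <= d * d by rewrite mulr_ge0 // ltW.
lra.
Qed.
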